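(* Let $G$ be a first countable, $\sigma$-compact, totally disconnected locally compact (Hausdorff) group, and let $\mathfrak{B}(G)$ be the Boolean algebra of all clopen subsets of $G$. Then $\mathfrak{B}(G)$ is left introverted if and only if $G$ is discrete or compact.
   Context: All topological spaces and groups are Hausdorff. For a topological group $G$, $\mathfrak{B}(G)$ denotes the Boolean algebra (under union, intersection, complement) of all clopen subsets of $G$. A $\mathfrak{B}(G)$-ultrafilter is an ultrafilter in this Boolean algebra. For a $\mathfrak{B}(G)$-ultrafilter $\mathcal{V}$ and $B\in\mathfrak{B}(G)$, put $\mathcal{V}\cdot B=\{s\in G: s^{-1}B\in\mathcal{V}\}$. The Boolean algebra $\mathfrak{B}(G)$ is called left introverted if $\mathcal{V}\cdot B\in\mathfrak{B}(G)$ (i.e. $\mathcal{V}\cdot B$ is clopen in $G$) for every $\mathfrak{B}(G)$-ultrafilter $\mathcal{V}$ and every $B\in\mathfrak{B}(G)$. *)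

(* Defs.v *)
From HB Require Import structures.
From mathcomp Require Import all_boot all_algebra.
From mathcomp Require Import all_classical all_reals topology.

Set Implicit Arguments.
Unset Strict Implicit.
Unset Printing Implicit Defensive.

Local Open Scope classical_set_scope.
Local Open Scope group_scope.

HB.structure Definition PreTopologicalGroup := {G of Topological G & Group G}.

HB.mixin Record PreTopologicalGroup_isTopologicalGroup G
    & PreTopologicalGroup G := {
  mulg_continuous : continuous (fun x : G * G => x.1 * x.2) ;
  invg_continuous : continuous (fun x : G => x^-1)
}.

(* Not assumed Hausdorff: use [hausdorff_space]. *)
#[short(type="topologicalGroupType")]
HB.structure Definition TopologicalGroup :=
  {G of PreTopologicalGroup G & PreTopologicalGroup_isTopologicalGroup G}.

Section Spaces.
Variable T : topologicalType.

(* The members of a local base are neighbourhoods, not necessarily open. *)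
Definition first_countable := forall x : T,
  exists2 N : set_system T, countable N &
    N `<=` nbhs x /\ forall U, nbhs x U -> exists2 W, N W & W `<=` U.

Definition sigma_compact (A : set T) :=
  exists2 K : nat -> set T, (forall n, compact (K n)) & A = \bigcup_n K n.

Definition discrete_space := forall A : set T, open A.

End Spaces.

Arguments first_countable : clear implicits.
Arguments discrete_space : clear implicits.

(* Filters of a Boolean algebra B of subsets of T. [Filter] and [UltraFilter]
   are the case B = [set: set T]; as in [UltraFilter], ultra means maximal. *)
Section FiltersIn.
Variables (T : Type) (B : set_system T).

Record proper_filter_in (V : set_system T) : Prop := {
  pfilter_in_sub : V `<=` B ;
  pfilter_in_not_empty : ~ V set0 ;
  pfilter_in_setT : V setT ;
  pfilter_in_setI : setI_closed V ;
  pfilter_inS : forall P Q : set T, B Q -> P `<=` Q -> V P -> V Q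
}.

Record ultrafilter_in (V : set_system T) : Prop := {
  ultrafilter_in_proper : proper_filter_in V ;
  ultrafilter_in_max : forall W, proper_filter_in W -> V `<=` W -> W = V
}.

End FiltersIn.

Section Introversion.
Variable G : groupType.

(* s A = {s * a | a in A} *)
Definition left_translate (s : G) (A : set G) : set G := [set s * a | a in A].

(* V . A = {s | s^-1 A in V} *)
Definition introvert (V : set_system G) (A : set G) : set G :=
  [set s | V (left_translate s^-1 A)].

Definition left_introverted (B : set_system G) :=
  forall V, ultrafilter_in B V -> forall A, B A -> B (introvert V A).

End Introversion.

(* Main.v *)
(* If G is compact, every ultrafilter of clopen sets consists of the clopen sets
   containing some point p, so that V . A = A p^-1.

   Conversely, let G be neither discrete nor compact, and let K be a compact
   open neighbourhood of 1. First countability gives clopen neighbourhoods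
   U_n of 1 inside K such that every s <> 1 lies outside U_n for n large, and
   sigma-compactness gives a sequence x_n tending to infinity so fast that
   the K x_n are pairwise disjoint and locally finite; hence B, the union of
   the U_n x_n, is clopen. Let V consist of the clopen A with x_n in A for
   p-almost all n, where p is a nonprincipal ultrafilter on nat. For s in K,
   s x_n lies in B iff s lies in U_n, so V . B meets K in {1} only; were V . B
   open, G would be discrete. *)

Require Import Defs.
From mathcomp Require Import all_boot all_algebra.
From mathcomp Require Import all_classical all_reals topology.

Local Open Scope classical_set_scope.

(** * Clopen neighbourhoods and locally finite unions *)

Section ClopenNeighbourhoods.
Variable T : topologicalType.
Implicit Types (A C K O U : set T) (D : set_system T).

(** Otherwise the traces of the members of [D] on the complement of [O] generate a proper filter. By
    compactness of [K] it has a cluster point, which lies in every member of [D] but not in [O]. *)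
Lemma bigcap_closed_subset_open D K O : compact K -> D K -> setI_closed D ->
  (forall A, D A -> closed A) -> open O -> \bigcap_(A in D) A `<=` O ->
  exists2 A, D A & A `<=` O.
Proof.
move=> cK DK DI Dcl oO DO; apply: contrapT => noA.
pose F := filter_from D (fun A => A `\` O).
have FF : ProperFilter F.
  apply: filter_from_proper; last first.
    move=> A DA; apply: contrapT => /nonemptyPn AO; apply: noA.
    by exists A => //; rewrite -setD_eq0.
  apply: filter_from_filter; first by exists K.
  by move=> A B DA DB; exists (A `&` B); [exact: DI|move=> y [[]]].
have [|p [_]] := cK F FF; first by exists K => // y [].
rewrite clusterE => clp.
have DOp A : D A -> (A `\` O) p.
  move=> DA; have : closure (A `\` O) p by apply: clp; exists A.
  by rewrite -(closure_id _).1//; apply: closedI (Dcl _ DA) (open_closedC oO).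
by case: (DOp _ DK) => _; apply; apply: DO => A /DOp[].
Qed.

(* The intersection of the relatively clopen subsets of the compact
   neighbourhood K that contain x is connected, hence equal to [set x]. *)
Lemma totally_disconnected_nbhs_clopen (x : T) U :
  hausdorff_space T -> totally_disconnected [set: T] ->
  locally_compact [set: T] -> nbhs x U ->
  exists C, [/\ clopen C, compact C, C x & C `<=` U].
Proof.
move=> hT tdT lcT Ux.
have [K0 /= K0x' [cK0 clK0]] := lcT x I.
have K0x : nbhs x K0.
  by move: K0x'; rewrite /within /=; apply: filterS => y /(_ I).
(* Keeping the closure of [N] in the interior of [K0] allows normality inside [K0] to be applied to
   closed subsets of that closure. *)
have [|N Nx NU] := @compact_regular T x K0 hT cK0 K0x (U `&` K0°).
  by apply: filterI => //; exact: nbhs_interior.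
set K := closure N in NU.
have KU : K `<=` U by move=> y /NU[].
have KK0 : K `<=` K0° by move=> y /NU[].
have clK : closed K := @closed_closure _ _.
have cK : compact K.
  apply: (subclosed_compact clK cK0); apply: subset_trans KK0 _.
  exact: interior_subset.
have NK : N° `<=` K.
  by apply: subset_trans (@interior_subset _ _) (@subset_closure _ _).
have xN : N° x := Nx.
pose D := [set A | [/\ A `<=` K, closed A, A x & closed (K `\` A)]].
have DK : D K by split=> //; [exact: NK|rewrite setDv; exact: closed0].
have DI : setI_closed D.
  move=> A B [AK clA Ax cA] [BK clB Bx cB]; split=> //.
  - by move=> y [/AK].
  - exact: closedI.
  - by rewrite setDIr; exact: closedU.
have Dcl A : D A -> closed A by case.
have Dsub := bigcap_closed_subset_open D K _ cK DK DI Dcl.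
pose Q := \bigcap_(A in D) A.
have QK : Q `<=` K by move=> y; apply.
have Qx : Q x by move=> A [].
have clQ : closed Q by apply: closed_bigI => A /Dcl.
have Qsplit A1 A2 : A1 `|` A2 = Q -> A1 `&` A2 = set0 ->
    closed A1 -> closed A2 -> A1 x -> A2 = set0.
  move=> A12 A120 cl1 cl2 A1x.
  have A1K : A1 `<=` K0° by move=> y A1y; apply/KK0/QK; rewrite -A12; left.
  have [|W /set_nbhsP[V [oV A1V VW]] WA2] :=
      @compact_normal_local T K0 hT cK0 A1 A1K cl1 (~` A2).
    apply/set_nbhsP; exists (~` A2); split=> //; first exact: closed_openC.
    by apply/disjoints_subset.
  have clW : closed (closure W) := @closed_closure _ _.
  (* Since [A] avoids the boundary region between [V] and [closure W], its traces on these two sets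
     agree. This common trace is relatively clopen, contains [x] and misses [A2]. *)
  have [||A [AK clA Ax clKA] AV] := Dsub (V `|` ~` closure W).
  - by apply: openU => //; exact: closed_openC.
  - rewrite -/Q -A12 => y [/A1V|A2y]; [by left|right=> /WA2]; exact.
  have DAV : D (A `&` closure W).
    split=> [y [/AK]//||| ].
    - exact: closedI.
    - by split=> //; apply/subset_closure/VW/A1V.
    - rewrite setDIr; have -> : K `\` A `|` K `\` closure W =
          K `\` A `|` K `\` V; last first.
        by apply: closedU => //; apply: closedI => //; exact: open_closedC.
      apply/seteqP; split=> y [|[Ky Wy]]; [by left| |by left|].
        by right; split=> // /VW/subset_closure.
      have [Ay|nAy] := pselect (A y); last by left.
      by have [//|?] := AV _ Ay; right.
  rewrite -subset0 => y A2y.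
  have Qy : Q y by rewrite -A12; right.
  by have [_ /WA2] := Qy _ DAV.
have Qconn : connected Q.
  move=> B [b Bb] [O oO BO] [F cF BF].
  have clB : closed B by rewrite BF; exact: closedI.
  have clQB : closed (Q `\` B).
    have -> : Q `\` B = Q `&` ~` O.
      by rewrite BO setDE setCI setIUr setICr set0U.
    by apply: closedI => //; exact: open_closedC.
  have BQ : B `<=` Q by rewrite BO => y [].
  have BQE : B `|` (Q `\` B) = Q by rewrite setDUK.
  have BQ0 : B `&` (Q `\` B) = set0 by rewrite setDIK.
  have [Bx|nBx] := pselect (B x).
    by rewrite -BQE (Qsplit _ _ BQE BQ0) // setU0.
  suff B0 : B = set0 by rewrite B0 in Bb.
  by apply: (Qsplit (Q `\` B) B) => //; rewrite 1?setUC 1?setIC.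
(* As [Q] reduces to [x], some member of [D] lies in the interior of [N], where relative openness in
   [K] is openness in the space. *)
have [||A [AK clA Ax clKA] AN] := Dsub N°; first exact: open_interior.
  rewrite -/Q => y Qy.
  have : connected_component [set: T] x y by exists Q.
  by rewrite tdT// => ->.
exists A; split=> //.
- split=> //; have -> : A = N° `&` ~` (K `\` A).
    apply/seteqP; split=> [y Ay|y [/NK Ky nKA]].
      by split; [exact: AN|case].
    by apply: contrapT => nAy; apply: nKA.
  by apply: openI; [exact: open_interior|exact: closed_openC].
- exact: subclosed_compact cK AK.
- by move=> y /AK/KU.
Qed.

Lemma first_countable_nbhs_seq (x : T) : first_countable T ->
  exists2 U : nat -> set T, forall n, nbhs x (U n) &
    forall A, nbhs x A -> exists n, U n `<=` A.
Proof.
move=> /(_ x)[N /pfcard_geP[->|[g]] [Nx NU]].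
  by have [W] := NU setT filterT.
exists g => [n|A /NU[W NW WA]]; first by apply: Nx; exact: funS.
by have [n _ gn] := @surj _ _ _ _ g W NW; exists n; rewrite gn.
Qed.

(** Each [U n] is chosen inside its predecessor and the [n]-th basic neighbourhood. The complement
    of [y] is a neighbourhood of [x], so it contains some [U N] and all later ones. *)
Lemma clopen_nbhs_seq (x : T) (K : set T) :
  hausdorff_space T -> first_countable T -> totally_disconnected [set: T] ->
  locally_compact [set: T] -> nbhs x K ->
  exists U : nat -> set T,
    [/\ forall n, clopen (U n), forall n, U n x, forall n, U n `<=` K &
      forall y, y != x -> exists N, forall n, (N <= n)%N -> ~ U n y].
Proof.
move=> hT fcT tdT lcT Kx.
have [g gx gbase] := first_countable_nbhs_seq x fcT.
have /choice[c cP] A : exists C, nbhs x A -> [/\ clopen C, C x & C `<=` A].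
  have [Ax|] := pselect (nbhs x A); last by exists set0.
  by have [C []] := totally_disconnected_nbhs_clopen x A hT tdT lcT Ax; exists C.
have nbhs_clopen C : clopen C -> C x -> nbhs x C.
  by move=> [oC _] Cx; apply: open_nbhs_nbhs.
pose U := fix U n := c ((if n is m.+1 then U m else K) `&` g n).
have UP n : [/\ clopen (U n), U n x &
    U n `<=` (if n is m.+1 then U m else K) `&` g n].
  elim: n => [|n [clU Ux _]]; apply: cP; apply: filterI => //.
  exact: nbhs_clopen.
have Udecr : {homo U : m n / (m <= n)%N >-> n `<=` m}.
  apply: homo_leq => [A|B A C BA CB|n] //; first exact: subset_trans CB BA.
  by have [_ _ UU] := UP n.+1; move=> y /UU[].
exists U; split=> [n|n|n|y yx].
- by have [] := UP n.
- by have [] := UP n.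
- apply: subset_trans (Udecr 0%N n _) _ => //.
  by have [_ _ UU] := UP 0%N; move=> y /UU[].
- have : nbhs x (~` [set y]).
    apply: open_nbhs_nbhs; split; last by move=> /= xy; rewrite xy eqxx in yx.
    apply: closed_openC.
    exact/accessible_closed_set1/hausdorff_accessible.
  move=> /gbase[N gN]; exists N => n Nn Uny.
  have [_ _ UN] := UP N.
  by have /UN[_ /gN] := Udecr _ _ Nn _ Uny; apply.
Qed.

(** Near a point outside the union only the first [N] sets matter, and their union is closed. *)
Lemma closed_locally_finite_bigcup (A : nat -> set T) :
  (forall n, closed (A n)) ->
  (forall y : T, exists2 W, nbhs y W &
    exists N, forall n, (N <= n)%N -> W `&` A n = set0) ->
  closed (\bigcup_n A n).
Proof.
move=> clA lfA y cly; apply: contrapT => nAy.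
have [W Wy [N WA]] := lfA y.
have clAN : closed (\bigcup_(n in `I_N) A n) by apply: closed_bigcup.
have [|z [[n _ Anz] [Wz nz]]] := cly (W `&` ~` \bigcup_(n in `I_N) A n).
  apply: filterI => //; apply: open_nbhs_nbhs; split; first exact: closed_openC.
  by move=> [n _ Any]; apply: nAy; exists n.
have [Nn|nN] := leqP N n; last by apply: nz; exists n.
by have : (W `&` A n) z by []; rewrite WA.
Qed.

End ClopenNeighbourhoods.

(** * Ultrafilters of clopen sets *)

Section UltrafiltersOfClopens.
Variable T : topologicalType.

Lemma preimage_ultrafilter_in (I : Type) (p : set_system I) (x : I -> T) :
  UltraFilter p -> ultrafilter_in (@clopen T) [set A | clopen A /\ p (x @^-1` A)].
Proof.
move=> pU; split; first split.
- by move=> A [].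
- by move=> [_]; rewrite preimage_set0; exact: filter_not_empty.
- by split; [exact: clopenT|rewrite preimage_setT; exact: filterT].
- move=> A B [clA pA] [clB pB]; split; first exact: clopenI.
  exact: filterI pA pB.
- move=> A B clB AB [_ pA]; split=> //; apply: filterS pA => i; exact: AB.
move=> W [Wcl W0 WT WI WS] VW; apply/seteqP; split=> // A WA.
split; first exact: Wcl.
(* If the preimage of [A] is not in [p], the complement of [A] is in the larger filter [W] along
   with [A], which is absurd. *)
have [//|pnA] := in_ultra_setVsetC (x @^-1` A) pU.
case: W0; rewrite -(setICr A); apply: WI => //; apply: VW.
by split=> //; apply/clopenC/Wcl.
Qed.

(** A cluster point [p] of [V] lies in all its members, as they are closed; maximality then gives
    equality. *)
Lemma compact_ultrafilter_in_clopen (V : set_system T) :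
  compact [set: T] -> ultrafilter_in (@clopen T) V ->
  exists p, V = [set A | clopen A /\ A p].
Proof.
move=> cT [[Vcl V0 VT VI VS] Vmax].
have FF : ProperFilter (filter_from V id).
  apply: filter_from_proper; last first.
    by move=> A VA; apply: contrapT => /nonemptyPn A0; apply: V0; rewrite -A0.
  apply: filter_from_filter; first by exists setT.
  by move=> A B VA VB; exists (A `&` B); first exact: VI.
have [|p [_]] := cT _ FF; first exact: filterT.
rewrite clusterE => clp; exists p; apply/esym/Vmax.
  split=> [A []//|[]//||A B [? ?] [? ?]|A B clB AB [_ Ap]].
  - by split=> //; exact: clopenT.
  - by split=> //; exact: clopenI.
  - by split=> //; exact: AB.
move=> A VA; split; first exact: Vcl.
have [_ clA] := Vcl _ VA.
by rewrite (closure_id A).1//; apply: clp; exists A.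
Qed.

End UltrafiltersOfClopens.

(** * Translations and sequences tending to infinity *)

Local Open Scope group_scope.

Lemma left_translateE (G : groupType) (s : G) (A : set G) :
  left_translate s A = (fun y => s^-1 * y) @^-1` A.
Proof.
apply/seteqP; split=> [_ [a Aa <-]|y Ay]; first by rewrite /= mulKg.
by exists (s^-1 * y) => //; rewrite mulVKg.
Qed.

Section TopologicalGroups.
Variable G : topologicalGroupType.
Implicit Types (A C K : set G) (s x y : G).

Lemma mulg_left_continuous s : continuous (fun y : G => s * y).
Proof.
move=> y; apply: (@continuous2_cvg _ _ _ _ (nbhs y) _ (fun _ => s) id).
- exact: (@mulg_continuous G (s, y)).
- exact: cvg_cst.
- exact: cvg_id.
Qed.

Lemma mulg_right_continuous s : continuous (fun y : G => y * s).
Proof.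
move=> y; apply: (@continuous2_cvg _ _ _ _ (nbhs y) _ id (fun _ => s)).
- exact: (@mulg_continuous G (y, s)).
- exact: cvg_id.
- exact: cvg_cst.
Qed.

Lemma discrete_space1 : open [set 1 : G] -> discrete_space G.
Proof.
move=> o1 A; rewrite openE => y Ay.
apply: (@filterS _ _ _ ((fun z => z * y^-1) @^-1` [set 1])).
  by move=> z /= zy; have <- : y = z by rewrite -(mulgVK y z) zy mul1g.
apply: open_nbhs_nbhs; split; last exact: mulgV.
by apply: open_comp o1 => z _; exact: mulg_right_continuous.
Qed.

(** The forbidden [x] form the product of the inverse of [K] with [K] and [C], a continuous image of
    a compact set, hence not all of [G]. *)
Lemma noncompact_translate K C : ~ compact [set: G] -> compact K -> compact C ->
  exists x, forall k l c, K k -> K l -> C c -> k * x <> l * c.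
Proof.
move=> ncG cK cC; apply: contrapT => nox; apply: ncG.
pose q (p : G * G * G) := p.1.1^-1 * (p.1.2 * p.2).
have -> : [set: G] = q @` (K `*` K `*` C).
  apply/seteqP; split=> // x _; apply: contrapT => qx; apply: nox.
  exists x => k l c Kk Kl Cc kx; apply: qx; exists (k, l, c) => //.
  by rewrite /q/= -kx mulKg.
apply: continuous_compact; last by do !apply: compact_setX.
apply: continuous_subspaceT => -[[k l] c].
have c11 : p.1.1 @[p --> (k, l, c)] --> k.
  by apply: (cvg_comp _ _ cvg_fst); exact: cvg_fst.
have c12 : p.1.2 @[p --> (k, l, c)] --> l.
  by apply: (cvg_comp _ _ cvg_fst); exact: cvg_snd.
apply: (@continuous2_cvg _ _ _ _ (nbhs (k, l, c)) _
  (fun p => p.1.1^-1) (fun p => p.1.2 * p.2)).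
- exact: (@mulg_continuous G (k^-1, l * c)).
- exact: (cvg_comp _ _ c11 (@invg_continuous G k)).
- apply: continuous2_cvg c12 cvg_snd; exact: (@mulg_continuous G (l, c)).
Qed.

Lemma escaping_sequence K (L : nat -> set G) : ~ compact [set: G] ->
  compact K -> (forall n, compact (L n)) ->
  exists x : nat -> G,
    (forall i n k l, (i < n)%N -> K k -> K l -> k * x n <> l * x i) /\
    (forall i n k l c, (i <= n)%N -> K k -> K l -> L i c -> k * x n <> l * c).
Proof.
move=> ncG cK cL.
have /choice[f fP] C : exists x, compact C ->
    forall k l c, K k -> K l -> C c -> k * x <> l * c.
  have [cC|] := pselect (compact C); last by exists 1.
  by have [x xP] := noncompact_translate K C ncG cK cC; exists x.
(* [E n] collects [L 0], ..., [L n] and the terms of index below [n]; the [n]-th term is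
   [f (E n)]. *)
pose E := fix E n := L n `|` if n is m.+1 then E m `|` [set f (E m)] else set0.
have cE n : compact (E n).
  elim: n => [|n cEn]; apply: compactU => //; first exact: compact0.
  by apply: compactU => //; exact: compact_set1.
have Emono : {homo E : i n / (i <= n)%N >-> i `<=` n}.
  apply: homo_leq => [A|B A C AB BC|n] //; first exact: subset_trans AB BC.
  by move=> y Ey; right; left.
exists (f \o E); split=> [i n k l ilt Kk Kl|i n k l c ile Kk Kl Lc];
  apply: (fP _ (cE n)) => //; apply: Emono ile _ _ || apply: Emono ilt _ _.
- by right; right.
- by case: (i) Lc => [|j] Lc; left.
Qed.

End TopologicalGroups.

(** * Left introversion of the algebra of clopen sets *)

Theorem theorem2p4 (G : topologicalGroupType)
    (hausdorffG : hausdorff_space G)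
    (first_countableG : first_countable G)
    (sigma_compactG : sigma_compact [set: G])
    (totally_disconnectedG : totally_disconnected [set: G])
    (locally_compactG : locally_compact [set: G]) :
  left_introverted (@clopen G) <-> (discrete_space G \/ compact [set: G]).
Proof.
split=> [introG|[dG|cG]]; last first.
- move=> V /(compact_ultrafilter_in_clopen _ _ cG)[p ->] A clA.
  have -> : introvert [set A | clopen A /\ A p] A = (fun s => s * p) @^-1` A.
    apply/seteqP; split=> s; rewrite /introvert /= left_translateE invgK.
      by case.
    by move=> Asp; split=> //; apply: preimage_clopen => //;
       exact: mulg_left_continuous.
  by apply: preimage_clopen => //; exact: mulg_right_continuous.
- by move=> V _ A _; split; [exact: dG|rewrite -openC; exact: dG].
apply: contrapT => /not_orP[ndG ncG]; apply: ndG; apply: discrete_space1.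
have [K [[oK clK] cK K1 _]] := totally_disconnected_nbhs_clopen _ (1 : G) setT
  hausdorffG totally_disconnectedG locally_compactG filterT.
have [L cL LG] := sigma_compactG.
have [x [x_disj x_esc]] := escaping_sequence _ _ _ ncG cK cL.
have [U [clU U1 UK Usep]] := clopen_nbhs_seq _ (1 : G) K hausdorffG
  first_countableG totally_disconnectedG locally_compactG
  (open_nbhs_nbhs (conj oK K1)).
pose Ux n := (fun y => y * (x n)^-1) @^-1` U n.
have clUx n : clopen (Ux n).
  by apply: preimage_clopen => //; exact: mulg_right_continuous.
pose B := \bigcup_n Ux n.
have clB : clopen B.
  split; first by apply: bigcup_open => n _; case: (clUx n).
  apply: closed_locally_finite_bigcup => [n|y]; first by case: (clUx n).
  have [m _ Lmy] : (\bigcup_n L n) y by rewrite -LG.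
  (* This neighbourhood is [K y]. As [y] is in [L m], it misses [K x_n], and so [U_n x_n], for all
     [n >= m]. *)
  exists ((fun z => z * y^-1) @^-1` K).
    apply: open_nbhs_nbhs; split; last by rewrite /= mulgV.
    by apply: open_comp oK => z _; exact: mulg_right_continuous.
  exists m => n mn; rewrite -subset0 => z [Kz /UK Kzn].
  by apply: (x_esc m n _ _ y mn Kzn Kz Lmy); rewrite !mulgVK.
have [p [pU pinf]] := @ultraFilterLemma nat \oo _.
pose V := [set A : set G | clopen A /\ p (x @^-1` A)].
have [oVB _] := introG V (preimage_ultrafilter_in _ _ _ x pU) B clB.
suff -> : [set 1] = introvert V B `&` K by exact: openI.
apply/seteqP; split=> [_ ->|s []].
  split=> //; rewrite /introvert /= left_translateE invgK; split.
    by apply: preimage_clopen => //; exact: mulg_left_continuous.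
  apply: filterS filterT => n _; exists n => //.
  by rewrite /Ux /= mul1g mulgV.
rewrite /introvert /= left_translateE invgK => -[_ ps] Ks.
apply: contrapT => /eqP /Usep[N UN].
(* Some [n >= N] has [s x_n] in [U_m x_m] for some [m]. Disjointness of the [K x_i] forces [m = n],
   so [s] is in [U_n], against the choice of [N]. *)
have /filter_ex[n [[m _ Umn] Nn]] :
    p (x @^-1` ((fun y => s * y) @^-1` B) `&` [set n | (N <= n)%N]).
  by apply: filterI => //; apply: pinf; exact: nbhs_infty_ge.
have Km : K (s * x n * (x m)^-1) := UK _ _ Umn.
have e : s * x n = s * x n * (x m)^-1 * x m by rewrite mulgVK.
have [mn|nm|mn] := ltngtP m n.
- exact: x_disj mn Ks Km e.
- exact: x_disj nm Km Ks (esym e).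
- by apply: (UN n Nn); move: Umn; rewrite /Ux /= mn mulgK.
Qed.
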